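(* Let $G$ be a group and let $B=\bigoplus_{t\in G}B_t$ be any $G$-graded algebra. Then the skew group algebra $(B\#G)\rtimes_{\beta^B}G$ is naturally isomorphic, as a $G$-graded algebra, to $\mathrm{FMat}_G(B)$.
   Context: Algebras are associative, not necessarily unital, over a fixed commutative associative unital ring $k$; $G$ is an arbitrary group (unit element $1$). A $G$-graded algebra is $B=\bigoplus_{t\in G}B_t$ with $B_sB_t\subseteq B_{st}$. $\mathrm{FMat}_G(B)$ is the algebra of $G\times G$-matrices over $B$ with finitely many nonzero entries; $b\,e_{r,s}$ denotes the matrix with $b$ at position $(r,s)$ and $0$ elsewhere. Smash product: $B\#G:=\bigoplus_{r,s\in G}B_{r^{-1}s}e_{r,s}$, a subalgebra of $\mathrm{FMat}_G(B)$. The (dual) action $\beta^B$ of $G$ on $B\#G$ by algebra automorphisms is $\beta^B_t(b\,e_{r,s})=b\,e_{tr,ts}$. Skew group algebra: $(B\#G)\rtimes_{\beta^B}G=\bigoplus_{t\in G}(B\#G)\delta_t$ with $(c\delta_s)(d\delta_t)=c\,\beta^B_s(d)\delta_{st}$, graded by declaring $(B\#G)\delta_t$ to be the homogeneous component of degree $t$. Grading on $\mathrm{FMat}_G(B)$: the component of degree $u\in G$ is $\mathrm{span}\{b\,e_{s,t}: b\in B_r,\ r,s,t\in G,\ srt^{-1}=u\}$. Naturality is with respect to homomorphisms of $G$-graded algebras $\phi:A\to B$, which induce the homomorphism $(A\#G)\rtimes_{\beta^A}G\to(B\#G)\rtimes_{\beta^B}G$, $a\,e_{r,s}\delta_t\mapsto\phi(a)e_{r,s}\delta_t$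 ($a\in A_{r^{-1}s}$), and the homomorphism $\mathrm{FMat}_G(A)\to\mathrm{FMat}_G(B)$ obtained by applying $\phi$ entrywise. *)

(* Defs.v *)
From HB Require Import structures.
From mathcomp Require Import all_boot all_order all_algebra finmap.
From mathcomp Require Import boolp classical_sets.

Set Implicit Arguments.
Unset Strict Implicit.
Unset Printing Implicit Defensive.

Import GRing.Theory.

Local Open Scope ring_scope.

(* Associative, not necessarily unital algebras over [k].  The product is the
   semigroup law [(x * y)%g] of the library (the ring structures of the
   library all have a unit). *)
HB.mixin Record Semigroup_isNUAlgebra (k : comPzRingType) A
    of GRing.Lmodule k A & Semigroup A := {
  numulDl : forall x y z : A, ((x + y) * z)%g = (x * z)%g + (y * z)%g;
  numulDr : forall x y z : A, (x * (y + z))%g = (x * y)%g + (x * z)%g;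
  nuscaleAl : forall (a : k) (x y : A), ((a *: x) * y)%g = a *: (x * y)%g;
  nuscaleAr : forall (a : k) (x y : A), (x * (a *: y))%g = a *: (x * y)%g
}.

#[short(type="nuAlgType")]
HB.structure Definition NUAlgebra (k : comPzRingType) :=
  {A of Semigroup_isNUAlgebra k A & GRing.Lmodule k A & Semigroup A}.

(* [grade_decomp] is the internal direct sum decomposition of [B] into the
   submodules [grade t]. *)
HB.mixin Record NUAlgebra_isGraded (k : comPzRingType) (G : groupType) B
    of NUAlgebra k B := {
  grade : G -> set B;
  grade0 : forall t, grade t 0;
  gradeD : forall t x y, grade t x -> grade t y -> grade t (x + y);
  gradeZ : forall t (a : k) x, grade t x -> grade t (a *: x);
  grade_decomp : forall x : B, exists! f : {fsfun G -> B with 0},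
    (forall t, grade t (f t)) /\ x = \sum_(t <- finsupp f) f t;
  gradeM : forall s t x y,
    grade s x -> grade t y -> grade (s * t)%g (x * y)%g
}.

#[short(type="gradedAlgType")]
HB.structure Definition GradedAlgebra (k : comPzRingType) (G : groupType) :=
  {B of NUAlgebra_isGraded k G B & NUAlgebra k B}.

Record graded_hom (k : comPzRingType) (G : groupType)
    (A B : gradedAlgType k G) := GradedHom {
  graded_hom_fun :> {linear A -> B};
  graded_homM : forall x y,
    graded_hom_fun (x * y)%g = (graded_hom_fun x * graded_hom_fun y)%g;
  graded_hom_grade : forall (t : G) x, grade t x -> grade t (graded_hom_fun x)
}.

Definition graded_iso (k : comPzRingType) (G : groupType)
    (A B : gradedAlgType k G) (f : graded_hom A B) :=
  exists g : graded_hom B A, cancel f g /\ cancel g f.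

Definition lin_span (k : comPzRingType) (V : lmodType k) (S : set V) : set V :=
  [set x | exists (n : nat) (c : 'I_n -> k) (v : 'I_n -> V),
     (forall i, S (v i)) /\ x = \sum_(i < n) c i *: v i].

(* The direct sum of copies of [V] indexed by [K]. *)
Definition dsum (K : choiceType) (V : zmodType) := {fsfun K -> V with 0}.

Section DSumZmod.
Context (K : choiceType) (V : zmodType).
Implicit Types x y z : dsum K V.

HB.instance Definition _ := Choice.on (dsum K V).

Definition dsum_zero : dsum K V := [fsfun with 0].
Definition dsum_opp x : dsum K V := [fsfun i in finsupp x => - x i].
Definition dsum_add x y : dsum K V :=
  [fsfun i in (finsupp x `|` finsupp y)%fset => x i + y i].

Lemma dsum_zeroE i : dsum_zero i = 0. Proof. by rewrite fsfunE. Qed.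

Lemma dsum_oppE x i : dsum_opp x i = - x i.
Proof. by rewrite fsfunE; case: finsuppP => //; rewrite oppr0. Qed.

Lemma dsum_addE x y i : dsum_add x y i = x i + y i.
Proof.
rewrite fsfunE inE.
by case: (finsuppP x i) => // _; case: (finsuppP y i) => //= _; rewrite addr0.
Qed.

Fact dsum_addA : associative dsum_add.
Proof. by move=> x y z; apply/fsfunP => i; rewrite !dsum_addE addrA. Qed.

Fact dsum_addC : commutative dsum_add.
Proof. by move=> x y; apply/fsfunP => i; rewrite !dsum_addE addrC. Qed.

Fact dsum_add0 : left_id dsum_zero dsum_add.
Proof. by move=> x; apply/fsfunP => i; rewrite dsum_addE dsum_zeroE add0r. Qed.

Fact dsum_addN : left_inverse dsum_zero dsum_opp dsum_add.
Proof.
by move=> x; apply/fsfunP => i; rewrite dsum_addE dsum_oppE dsum_zeroE addNr.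
Qed.

HB.instance Definition _ := GRing.isZmodule.Build (dsum K V)
  dsum_addA dsum_addC dsum_add0 dsum_addN.

Definition dsum_single (i : K) (v : V) : dsum K V :=
  [fsfun j in [fset i]%fset => v].

Lemma dsum_singleE i v j : dsum_single i v j = if j == i then v else 0.
Proof. by rewrite fsfunE inE. Qed.

Lemma dsum0 i : (0 : dsum K V) i = 0. Proof. exact: dsum_zeroE. Qed.
Lemma dsumN x i : (- x) i = - x i. Proof. exact: dsum_oppE. Qed.
Lemma dsumD x y i : (x + y) i = x i + y i. Proof. exact: dsum_addE. Qed.

Lemma dsum_sum I (r : seq I) (P : pred I) (F : I -> dsum K V) j :
  (\sum_(i <- r | P i) F i) j = \sum_(i <- r | P i) F i j.
Proof.
by apply: (big_morph (fun x : dsum K V => x j)) => [x y|];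
  [exact: dsumD|exact: dsum0].
Qed.

Lemma dsum_singleD i : {morph dsum_single i : u v / u + v}.
Proof.
move=> u v; apply/fsfunP => j; rewrite dsumD !dsum_singleE.
by case: eqP; rewrite ?addr0.
Qed.

Lemma dsum_single0 i : dsum_single i 0 = 0.
Proof. by apply/fsfunP => j; rewrite dsum_singleE dsum0 if_same. Qed.

Lemma dsum_expand x : x = \sum_(i <- finsupp x) dsum_single i (x i).
Proof.
apply/fsfunP => j; rewrite dsum_sum; case: (finsuppP x j) => [xj|xj].
  rewrite big_seq big1 // => i xi; rewrite dsum_singleE.
  by case: eqP => // ji; rewrite ji xi in xj.
rewrite (bigD1_seq j) //= dsum_singleE eqxx big1 ?addr0 // => i ij.
by rewrite dsum_singleE eq_sym (negbTE ij).
Qed.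

End DSumZmod.

Section DSumLmod.
Context (k : comPzRingType) (K : choiceType) (V : lmodType k).
Implicit Types x y z : dsum K V.

Definition dsum_scale (a : k) x : dsum K V :=
  [fsfun i in finsupp x => a *: x i].

Lemma dsum_scaleE a x i : dsum_scale a x i = a *: x i.
Proof. by rewrite fsfunE; case: finsuppP => //; rewrite scaler0. Qed.

Fact dsum_scaleA a b x : dsum_scale a (dsum_scale b x) = dsum_scale (a * b) x.
Proof. by apply/fsfunP => i; rewrite !dsum_scaleE scalerA. Qed.

Fact dsum_scale1 : left_id 1 dsum_scale.
Proof. by move=> x; apply/fsfunP => i; rewrite dsum_scaleE scale1r. Qed.

Fact dsum_scaleDr : right_distributive dsum_scale +%R.
Proof.
by move=> a x y; apply/fsfunP => i; rewrite !(dsum_scaleE, dsumD) scalerDr.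
Qed.

Fact dsum_scaleDl x : {morph dsum_scale^~ x : a b / a + b}.
Proof.
by move=> a b; apply/fsfunP => i; rewrite !(dsum_scaleE, dsumD) scalerDl.
Qed.

HB.instance Definition _ := GRing.Zmodule_isLmodule.Build k (dsum K V)
  dsum_scaleA dsum_scale1 dsum_scaleDr dsum_scaleDl.

Lemma dsumZ a x i : (a *: x) i = a *: x i. Proof. exact: dsum_scaleE. Qed.

Lemma dsum_singleZ i a v : dsum_single i (a *: v) = a *: dsum_single i v.
Proof.
apply/fsfunP => j; rewrite dsumZ !dsum_singleE.
by case: eqP; rewrite ?scaler0.
Qed.

(* The linear map on the direct sum with components [F i]. *)
Definition dsum_lift (W : lmodType k) (F : K -> V -> W) x : W :=
  \sum_(i <- finsupp x) F i (x i).

Section Lift.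
Context (W : lmodType k) (F : K -> V -> W) (linF : forall i, linear (F i)).

Let F0 i : F i 0 = 0.
Proof. by have := linF i (-1) 0 0; rewrite !scaleN1r oppr0 addr0 addNr. Qed.

Lemma dsum_lift_widen (S : {fset K}) x : (finsupp x `<=` S)%fset ->
  dsum_lift F x = \sum_(i <- S) F i (x i).
Proof.
move=> xS; rewrite /dsum_lift; apply: big_fset_incl => // i _ xi.
by rewrite fsfun_dflt // F0.
Qed.

Lemma dsum_lift_linear : linear (dsum_lift F).
Proof.
move=> a x y.
set S := (finsupp x `|` finsupp y `|` finsupp (a *: x + y)%R)%fset.
have Sx : (finsupp x `<=` S)%fset by apply/fsubsetP => i; rewrite !inE => ->.
have Sy : (finsupp y `<=` S)%fset.
  by apply/fsubsetP => i; rewrite !inE => ->; rewrite orbT.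
have Sz : (finsupp (a *: x + y)%R `<=` S)%fset.
  by apply/fsubsetP => i; rewrite !inE => ->; rewrite orbT.
rewrite (dsum_lift_widen Sx) (dsum_lift_widen Sy) (dsum_lift_widen Sz).
rewrite scaler_sumr -big_split; apply: eq_bigr => i _ /=.
by rewrite dsumD dsumZ linF.
Qed.

Lemma dsum_lift_single i v : dsum_lift F (dsum_single i v) = F i v.
Proof.
rewrite (@dsum_lift_widen [fset i]%fset).
  by rewrite big_seq_fset1 dsum_singleE eqxx.
apply/fsubsetP => j; rewrite mem_finsupp dsum_singleE inE.
by case: (j == i) => //; rewrite eqxx.
Qed.

End Lift.
End DSumLmod.

Lemma dsum_ind (K : choiceType) (V : zmodType) (P : dsum K V -> Prop) :
    P 0 -> (forall x y, P x -> P y -> P (x + y)) ->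
    (forall i v, P (dsum_single i v)) ->
  forall x, P x.
Proof.
move=> P0 PD P1 x; rewrite [x]dsum_expand.
by elim/big_ind: _ => [|y z|i _]; [exact: P0|exact: PD|exact: P1].
Qed.

Section DSumMul.
Context (k : comPzRingType) (K : choiceType) (V : lmodType k).
Variable m : K -> K -> V -> V -> dsum K V.
Implicit Types x y z : dsum K V.

(* The bilinear product such that the product of [u] in the summand [i] with
   [v] in the summand [j] is [m i j u v]. *)
Definition dsum_mul x y : dsum K V :=
  dsum_lift (fun i u => dsum_lift (fun j v => m i j u v) y) x.

Hypothesis linl : forall i j v, linear (fun u => m i j u v).
Hypothesis linr : forall i j u, linear (m i j u).

Let lin1 y i : linear (fun u => dsum_lift (fun j v => m i j u v) y).
Proof.
move=> a u v; rewrite /dsum_lift scaler_sumr -big_split.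
by apply: eq_bigr => j _; rewrite linl.
Qed.

Lemma dsum_mul_linl y : linear (dsum_mul^~ y).
Proof. exact: dsum_lift_linear. Qed.

Lemma dsum_mul_linr x : linear (dsum_mul x).
Proof.
move=> a y z; rewrite /dsum_mul {1 3 5}/dsum_lift scaler_sumr -big_split.
by apply: eq_bigr => i _; rewrite dsum_lift_linear.
Qed.

Lemma dsum_mul_single i j u v :
  dsum_mul (dsum_single i u) (dsum_single j v) = m i j u v.
Proof. by rewrite /dsum_mul dsum_lift_single ?dsum_lift_single. Qed.

Lemma dsum_mulDl x y z : dsum_mul (x + y) z = dsum_mul x z + dsum_mul y z.
Proof. by have := dsum_mul_linl z 1 x y; rewrite !scale1r. Qed.

Lemma dsum_mulDr x y z : dsum_mul x (y + z) = dsum_mul x y + dsum_mul x z.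
Proof. by have := dsum_mul_linr x 1 y z; rewrite !scale1r. Qed.

Lemma dsum_mul0l x : dsum_mul 0 x = 0.
Proof. by apply: (addIr (dsum_mul 0 x)); rewrite -dsum_mulDl !add0r. Qed.

Lemma dsum_mul0r x : dsum_mul x 0 = 0.
Proof. by apply: (addIr (dsum_mul x 0)); rewrite -dsum_mulDr !add0r. Qed.

Lemma dsum_mulZl a x y : dsum_mul (a *: x) y = a *: dsum_mul x y.
Proof. by have := dsum_mul_linl y a x 0; rewrite dsum_mul0l !addr0. Qed.

Lemma dsum_mulZr a x y : dsum_mul x (a *: y) = a *: dsum_mul x y.
Proof. by have := dsum_mul_linr x a y 0; rewrite dsum_mul0r !addr0. Qed.

Lemma dsum_mulA :
  (forall i j l u v w,
    dsum_mul (dsum_single i u) (m j l v w) =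
    dsum_mul (m i j u v) (dsum_single l w)) ->
  associative dsum_mul.
Proof.
move=> mA; elim/dsum_ind => [|x1 x2 IH1 IH2|i u] y z.
- by rewrite !dsum_mul0l.
- by rewrite !dsum_mulDl IH1 IH2.
elim/dsum_ind: y => [|y1 y2 IH1 IH2|j v].
- by rewrite dsum_mul0r dsum_mul0l dsum_mul0r.
- by rewrite dsum_mulDl !dsum_mulDr dsum_mulDl IH1 IH2.
elim/dsum_ind: z => [|z1 z2 IH1 IH2|l w].
- by rewrite !dsum_mul0r.
- by rewrite !dsum_mulDr IH1 IH2.
by rewrite !dsum_mul_single mA.
Qed.

End DSumMul.

Section NUAlgebraTheory.
Context (k : comPzRingType) (A : nuAlgType k).
Implicit Types x y : A.

Lemma numul0l x : (0 * x)%g = 0 :> A.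
Proof. by apply: (addIr (0 * x)%g); rewrite -numulDl !add0r. Qed.

Lemma numul0r x : (x * 0)%g = 0 :> A.
Proof. by apply: (addIr (x * 0)%g); rewrite -numulDr !add0r. Qed.

Lemma numul_linl y : linear (fun x : A => (x * y)%g).
Proof. by move=> a u v; rewrite numulDl nuscaleAl. Qed.

Lemma numul_linr x : linear (fun y : A => (x * y)%g).
Proof. by move=> a u v; rewrite numulDr nuscaleAr. Qed.

End NUAlgebraTheory.

Lemma dsum_single_linear (k : comPzRingType) (K : choiceType) (V : lmodType k)
  (i : K) : linear (@dsum_single K V i).
Proof. by move=> a u v; rewrite dsum_singleD dsum_singleZ. Qed.

(* The algebra of [G] x [G]-matrices over [B] with finitely many nonzero
   entries; [unit_mx b r s] is the matrix b e_{r,s}. *)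
Definition fmat (k : comPzRingType) (G : groupType) (B : nuAlgType k) :=
  dsum (G * G)%type B.

Section FMat.
Context (k : comPzRingType) (G : groupType) (B : nuAlgType k).
Implicit Types M N : fmat G B.

HB.instance Definition _ := GRing.Lmodule.on (fmat G B).

Definition unit_mx (b : B) (r s : G) : fmat G B := dsum_single (r, s) b.

Lemma fmat_ind (P : fmat G B -> Prop) :
    P 0 -> (forall M N, P M -> P N -> P (M + N)) ->
    (forall b r s, P (unit_mx b r s)) ->
  forall M, P M.
Proof. by move=> P0 PD P1; apply: dsum_ind => // -[r s] b; exact: P1. Qed.

Definition unit_mx_mul (p q : G * G) (b c : B) : fmat G B :=
  if p.2 == q.1 then unit_mx (b * c)%g p.1 q.2 else 0.

Definition fmat_mul : fmat G B -> fmat G B -> fmat G B := dsum_mul unit_mx_mul.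

Let linl p q c : linear (fun b => unit_mx_mul p q b c).
Proof.
move=> a u v; rewrite /unit_mx_mul; case: eqP => _.
  by rewrite numul_linl; exact: dsum_single_linear.
by rewrite scaler0 addr0.
Qed.

Let linr p q b : linear (unit_mx_mul p q b).
Proof.
move=> a u v; rewrite /unit_mx_mul; case: eqP => _.
  by rewrite numul_linr; exact: dsum_single_linear.
by rewrite scaler0 addr0.
Qed.

Lemma fmat_mul_unit b c r s t u :
  fmat_mul (unit_mx b r s) (unit_mx c t u) =
  if s == t then unit_mx (b * c)%g r u else 0.
Proof. exact: dsum_mul_single. Qed.

Fact fmat_mulA : associative fmat_mul.
Proof.
apply: dsum_mulA => // -[p1 p2] [q1 q2] [r1 r2] u v w.
rewrite [unit_mx_mul (q1, q2) _ _ _]/unit_mx_mul.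
rewrite [unit_mx_mul (p1, p2) (q1, q2) _ _]/unit_mx_mul /=.
case: eqP => [qr|qr]; case: eqP => [pq|pq].
- by rewrite !dsum_mul_single // /unit_mx_mul /= pq qr !eqxx mulgA.
- rewrite dsum_mul_single // dsum_mul0l // /unit_mx_mul /=.
  by case: eqP.
- rewrite dsum_mul_single // dsum_mul0r // /unit_mx_mul /=.
  by case: eqP.
- by rewrite dsum_mul0l // dsum_mul0r.
Qed.

HB.instance Definition _ := isSemigroup.Build (fmat G B) fmat_mulA.

Lemma fmat_mulE M N : (M * N)%g = fmat_mul M N. Proof. by []. Qed.

HB.instance Definition _ := Semigroup_isNUAlgebra.Build k (fmat G B)
  (dsum_mulDl linl) (dsum_mulDr linr) (dsum_mulZl linl) (dsum_mulZr linr).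

Lemma unit_mxE b r s p : unit_mx b r s p = if p == (r, s) then b else 0.
Proof. exact: dsum_singleE. Qed.

Lemma fmat_mul_unit_entry M c t u r s :
  fmat_mul M (unit_mx c t u) (r, s) =
  if s == u then (M (r, t) * c)%g else 0.
Proof.
elim/fmat_ind: M => [|M N IHM IHN|b p q].
- by rewrite /fmat_mul dsum_mul0l // !dsum0 numul0l if_same.
- rewrite /fmat_mul dsum_mulDl // !dsumD -/fmat_mul IHM IHN numulDl.
  by case: eqP => // _; rewrite addr0.
rewrite fmat_mul_unit unit_mxE xpair_eqE.
rewrite (eq_sym t); case: (q == t).
  by rewrite andbT unit_mxE xpair_eqE; case: (r == p); case: (s == u);
    rewrite ?numul0l.
by rewrite andbF numul0l dsum0 if_same.
Qed.

(* The product is the usual product of matrices. *)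
Lemma fmat_mul_entry M N r s (S : {fset G}) :
    (forall t, t \notin S -> M (r, t) = 0) ->
  (M * N)%g (r, s) = \sum_(t <- S) (M (r, t) * N (t, s))%g.
Proof.
move=> MS; rewrite fmat_mulE.
elim/fmat_ind: N => [|N N' IHN IHN'|c t u].
- rewrite /fmat_mul dsum_mul0r // dsum0 big1 // => t _.
  by rewrite dsum0 numul0r.
- rewrite /fmat_mul dsum_mulDr // dsumD -/fmat_mul IHN IHN' -big_split.
  by apply: eq_bigr => t _; rewrite dsumD numulDr.
rewrite fmat_mul_unit_entry.
under eq_bigr do rewrite unit_mxE xpair_eqE.
case: (s == u); last by rewrite big1 // => t' _; rewrite andbF numul0r.
under eq_bigr do rewrite andbT.
have [tS|tS] := boolP (t \in S); last first.
  rewrite MS // numul0l big_seq big1 // => t' t'S.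
  by case: eqP => [tt'|]; [rewrite tt' (negbTE tS) in t'S|rewrite numul0r].
rewrite (bigD1_seq t) ?fset_uniq //= eqxx big1 ?addr0 // => t' tt'.
by rewrite (negbTE tt') numul0r.
Qed.

End FMat.

Section Span.
Context (k : comPzRingType) (V : lmodType k) (S : set V).

Lemma sub_span x : S x -> lin_span S x.
Proof.
move=> Sx; exists 1%N, (fun=> 1), (fun=> x); split => //.
by rewrite big_ord1 scale1r.
Qed.

Lemma span0 : lin_span S 0.
Proof.
exists 0%N, (fun=> 0), (fun=> 0); split; first by case.
by rewrite big_ord0.
Qed.

Lemma spanD x y : lin_span S x -> lin_span S y -> lin_span S (x + y).
Proof.
move=> [n [c [v [Sv ->]]]] [m [d [w [Sw ->]]]].
exists (n + m)%N.
exists (fun i => match fintype.split i with inl j => c j | inr j => d j end).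
exists (fun i => match fintype.split i with inl j => v j | inr j => w j end).
split=> [i|]; first by case: fintype.split.
rewrite big_split_ord /=; congr (_ + _); apply: eq_bigr => i _.
  by rewrite (unsplitK (inl i : 'I_n + 'I_m)%type).
by rewrite (unsplitK (inr i : 'I_n + 'I_m)%type).
Qed.

Lemma spanZ a x : lin_span S x -> lin_span S (a *: x).
Proof.
move=> [n [c [v [Sv ->]]]]; exists n, (fun i => a * c i), v; split => //.
by rewrite scaler_sumr; apply: eq_bigr => i _; rewrite scalerA.
Qed.

Lemma span_ind (P : V -> Prop) :
    P 0 -> (forall x y, P x -> P y -> P (x + y)) ->
    (forall a x, P x -> P (a *: x)) -> (forall x, S x -> P x) ->
  forall x, lin_span S x -> P x.
Proof.
move=> P0 PD PZ PS _ [n [c [v [Sv ->]]]].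
by elim/big_ind: _ => [|x y|i _]; [exact: P0|exact: PD|exact/PZ/PS].
Qed.

End Span.

Section DirectSum.
Context (k : comPzRingType) (K : choiceType) (V : lmodType k).
Variable gr : K -> set V.
Implicit Types f g : dsum K V.

Definition dsum_total f : V := dsum_lift (fun _ v => v) f.

Let linid (i : K) : linear (fun v : V => v). Proof. by []. Qed.

Lemma dsum_totalD f g : dsum_total (f + g) = dsum_total f + dsum_total g.
Proof. by have := dsum_lift_linear linid 1 f g; rewrite !scale1r. Qed.

Lemma dsum_total0 : dsum_total 0 = 0.
Proof. by apply: (addIr (dsum_total 0)); rewrite -dsum_totalD !add0r. Qed.

Lemma dsum_totalN f : dsum_total (- f) = - dsum_total f.
Proof.
by apply: (addIr (dsum_total f)); rewrite -dsum_totalD !addNr dsum_total0.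
Qed.

Lemma dsum_total_single i v : dsum_total (dsum_single i v) = v.
Proof. exact: dsum_lift_single. Qed.

Hypothesis gr0 : forall t, gr t 0.
Hypothesis grD : forall t x y, gr t x -> gr t y -> gr t (x + y).
Hypothesis grZ : forall t (a : k) x, gr t x -> gr t (a *: x).

Definition decomposable x :=
  exists f, (forall t, gr t (f t)) /\ x = dsum_total f.

Lemma decomposable0 : decomposable 0.
Proof. by exists 0; split=> [t|]; rewrite ?dsum0 ?dsum_total0. Qed.

Lemma decomposableD x y :
  decomposable x -> decomposable y -> decomposable (x + y).
Proof.
move=> [f [fg ->]] [g [gg ->]]; exists (f + g).
by split=> [t|]; rewrite ?dsumD ?dsum_totalD //; exact: grD.
Qed.

Lemma decomposable_gr t x : gr t x -> decomposable x.
Proof.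
move=> grx; exists (dsum_single t x).
split=> [s|]; last by rewrite dsum_total_single.
by rewrite dsum_singleE; case: eqP => // ->.
Qed.

Lemma direct_sum_decomp :
    (forall x, decomposable x) ->
    (forall f, (forall t, gr t (f t)) -> dsum_total f = 0 -> f = 0) ->
  forall x, exists! f : {fsfun K -> V with 0},
    (forall t, gr t (f t)) /\ x = \sum_(t <- finsupp f) f t.
Proof.
move=> ex uniq x; have [f [fg xE]] := ex x; exists f; split=> // g [gg xE'].
apply/eqP; rewrite -[_ == _](subr_eq0 (f : dsum K V)); apply/eqP/uniq.
  by move=> t; rewrite dsumD dsumN -scaleN1r; apply/grD/grZ.
by rewrite dsum_totalD dsum_totalN -xE [X in _ - X](_ : _ = x) ?subrr.
Qed.

End DirectSum.

Section GradedTheory.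
Context (k : comPzRingType) (G : groupType) (B : gradedAlgType k G).

Lemma grade_inj0 (f : dsum G B) :
  (forall t, grade t (f t)) -> dsum_total f = 0 -> f = 0.
Proof.
move=> fg f0; have [g [_ guniq]] := grade_decomp (0 : B).
rewrite -(guniq f) //; apply/guniq; split=> [t|].
  by rewrite dsum0; exact: grade0.
by rewrite -[RHS]/(dsum_total (0 : dsum G B)) dsum_total0.
Qed.

End GradedTheory.

Section FMatGrading.
Context (k : comPzRingType) (G : groupType) (B : gradedAlgType k G).

Definition fmat_grade (u : G) : set (fmat G B) :=
  lin_span [set M | exists r s t (b : B),
    [/\ grade r b, (s * r * t^-1 = u)%g & M = unit_mx b s t]].

Lemma fmat_grade_entry u M : fmat_grade u M ->
  forall s t, grade (s^-1 * u * t)%g (M (s, t)).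
Proof.
move=> Mu s t; move: M Mu; apply: span_ind => [|M N|a M|].
- by rewrite dsum0; exact: grade0.
- by rewrite dsumD; exact: gradeD.
- by rewrite dsumZ; exact: gradeZ.
move=> _ [r [s' [t' [b [br <- ->]]]]].
rewrite unit_mxE xpair_eqE; case: eqP => [->|_]; last exact: grade0.
case: eqP => [->|_]; last exact: grade0.
by rewrite -!mulgA mulKg mulVg mulg1.
Qed.

Fact fmat_gradeM u v M N :
  fmat_grade u M -> fmat_grade v N -> fmat_grade (u * v)%g (M * N)%g.
Proof.
move=> Mu Nv; move: M Mu; apply: span_ind => [|M M'|a M|].
- by rewrite numul0l; exact: span0.
- by rewrite numulDl; exact: spanD.
- by rewrite nuscaleAl; exact: spanZ.
move=> _ [r [s [t [b [br <- ->]]]]].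
move: N Nv; apply: span_ind => [|N N'|a N|].
- by rewrite numul0r; exact: span0.
- by rewrite numulDr; exact: spanD.
- by rewrite nuscaleAr; exact: spanZ.
move=> _ [r' [s' [t' [b' [b'r <- ->]]]]].
rewrite fmat_mulE fmat_mul_unit; case: eqP => [ts|_]; last exact: span0.
apply: sub_span; exists (r * r')%g, s, t', (b * b')%g; split=> //.
  exact: gradeM.
by rewrite ts -!mulgA mulKg.
Qed.

Let gr0 u : fmat_grade u 0. Proof. exact: span0. Qed.
Let grD u M N : fmat_grade u M -> fmat_grade u N -> fmat_grade u (M + N).
Proof. exact: spanD. Qed.
Let grZ u a M : fmat_grade u M -> fmat_grade u (a *: M).
Proof. exact: spanZ. Qed.

Fact fmat_grade_decomp (M : fmat G B) :
  exists! f : {fsfun G -> fmat G B with 0},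
    (forall t, fmat_grade t (f t)) /\ M = \sum_(t <- finsupp f) f t.
Proof.
move: M; apply: direct_sum_decomp => //.
  elim/fmat_ind => [|M N|b s t].
  - exact: decomposable0.
  - exact: decomposableD.
  have [f [[fg bE] _]] := grade_decomp b.
  rewrite bE /unit_mx.
  rewrite (big_morph _ (dsum_singleD (s, t)) (dsum_single0 _ (s, t))).
  elim/big_ind: _ => [|x y|r _]; [exact: decomposable0|exact: decomposableD|].
  apply: (@decomposable_gr _ _ _ _ gr0 (s * r * t^-1)%g).
  by apply: sub_span; exists r, s, t, (f r).
move=> f fg f0; apply/fsfunP => u; rewrite dsum0; apply/fsfunP => -[s t].
pose h (v : G) := (s^-1 * v * t)%g.
have h_inj : injective h by move=> v w /mulIg /mulgI.
pose g : dsum G B := \sum_(v <- finsupp f) dsum_single (h v) (f v (s, t)).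
have gE v : g (h v) = f v (s, t).
  rewrite /g dsum_sum; case: (finsuppP f v) => [vf|vf].
    rewrite dsum0 big_seq big1 // => w wf; rewrite dsum_singleE.
    by case: eqP => // /h_inj vw; rewrite vw wf in vf.
  rewrite (bigD1_seq v) ?fset_uniq //= dsum_singleE eqxx big1 ?addr0 // => w wv.
  by rewrite dsum_singleE (inj_eq h_inj) eq_sym (negbTE wv).
rewrite -gE (@grade_inj0 _ _ B g) ?dsum0 // => [v|].
  rewrite /g dsum_sum; elim/big_ind: _ => [|x y|w _].
  - exact: grade0.
  - exact: gradeD.
  rewrite dsum_singleE; case: eqP => [->|_]; last exact: grade0.
  exact: fmat_grade_entry.
rewrite /g (big_morph _ (@dsum_totalD _ _ _) (@dsum_total0 _ _ _)).
under eq_bigr do rewrite dsum_total_single.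
rewrite -dsum_sum; move: f0; rewrite /dsum_total /dsum_lift => ->.
by rewrite dsum0.
Qed.

HB.instance Definition _ := NUAlgebra_isGraded.Build k G (fmat G B)
  gr0 grD grZ fmat_grade_decomp fmat_gradeM.

End FMatGrading.

(* The subalgebra B # G of [fmat G B]. *)
Section Smash.
Context (k : comPzRingType) (G : groupType) (B : gradedAlgType k G).

Definition smash_pred : {pred fmat G B} :=
  fun M => `[< forall r s, grade (r^-1 * s)%g (M (r, s)) >].

Lemma smash_predP (M : fmat G B) :
  reflect (forall r s, grade (r^-1 * s)%g (M (r, s))) (M \in smash_pred).
Proof. exact: asboolP. Qed.

Fact smash_submod_closed : submod_closed smash_pred.
Proof.
split=> [|a M N /smash_predP MP /smash_predP NP]; apply/smash_predP => r s.
  by rewrite dsum0; exact: grade0.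
by rewrite dsumD dsumZ; exact/gradeD/NP/gradeZ.
Qed.

HB.instance Definition _ := GRing.isSubmodClosed.Build k (fmat G B) smash_pred
  smash_submod_closed.

Fact smash_mul_closed :
  {in smash_pred &, forall M N : fmat G B, (M * N)%g \in smash_pred}.
Proof.
move=> M N /smash_predP MP /smash_predP NP; apply/smash_predP => r s.
pose S := [fset p.2 | p in finsupp M]%fset.
rewrite (@fmat_mul_entry _ _ _ _ _ _ _ S) => [|t tS].
  elim/big_ind: _ => [|x y|t _]; [exact: grade0|exact: gradeD|].
  by have := gradeM _ _ _ _ (MP r t) (NP t s); rewrite -mulgA mulVKg.
apply: fsfun_dflt; apply: contra tS => rtM.
by apply/imfsetP; exists (r, t).
Qed.

Record smash := Smash { smash_val :> fmat G B; _ : smash_val \in smash_pred }.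

HB.instance Definition _ := [isSub for smash_val].
HB.instance Definition _ := [Choice of smash by <:].
HB.instance Definition _ := [SubChoice_isSubLmodule of smash by <:].

Implicit Types x y z : smash.

Lemma smash_valP x r s : grade (r^-1 * s)%g (smash_val x (r, s)).
Proof. by move: r s; apply/smash_predP; exact: valP. Qed.

Definition smash_mul x y : smash := Smash (smash_mul_closed (valP x) (valP y)).

Fact smash_mulA : associative smash_mul.
Proof. by move=> x y z; apply: val_inj; exact: mulgA. Qed.

HB.instance Definition _ := isSemigroup.Build smash smash_mulA.

Fact smash_mulDl x y z : ((x + y) * z)%g = (x * z)%g + (y * z)%g.
Proof. by apply: val_inj; rewrite raddfD; exact: numulDl. Qed.
Fact smash_mulDr x y z : (x * (y + z))%g = (x * y)%g + (x * z)%g.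
Proof. by apply: val_inj; rewrite raddfD; exact: numulDr. Qed.
Fact smash_scaleAl (a : k) x y : ((a *: x) * y)%g = a *: (x * y)%g.
Proof. by apply: val_inj; rewrite linearZ; exact: nuscaleAl. Qed.
Fact smash_scaleAr (a : k) x y : (x * (a *: y))%g = a *: (x * y)%g.
Proof. by apply: val_inj; rewrite linearZ; exact: nuscaleAr. Qed.

HB.instance Definition _ := Semigroup_isNUAlgebra.Build k smash
  smash_mulDl smash_mulDr smash_scaleAl smash_scaleAr.

End Smash.

Arguments smash {k G} B.

(* Actions of [G] on the algebra [C] by algebra automorphisms. *)
Record algAction (k : comPzRingType) (G : groupType) (C : nuAlgType k) :=
  AlgAction {
    alg_act :> G -> C -> C;
    alg_act_linear : forall t, linear (alg_act t);
    alg_actM : forall t x y,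
      alg_act t (x * y)%g = (alg_act t x * alg_act t y)%g;
    alg_act1 : forall x, alg_act 1%g x = x;
    alg_act_comp : forall s t x, alg_act (s * t)%g x = alg_act s (alg_act t x)
  }.

(* The skew group algebra; [skew_delta c t] is the element c delta_t. *)
Definition skewalg (k : comPzRingType) (G : groupType) (C : nuAlgType k)
  (beta : algAction G C) := dsum G C.

Section Skew.
Context (k : comPzRingType) (G : groupType) (C : nuAlgType k).
Context (beta : algAction G C).
Implicit Types x y : skewalg beta.

HB.instance Definition _ := GRing.Lmodule.on (skewalg beta).

Definition skew_delta (c : C) (t : G) : skewalg beta := dsum_single t c.

Lemma skew_ind (P : skewalg beta -> Prop) :
    P 0 -> (forall x y, P x -> P y -> P (x + y)) ->
    (forall c t, P (skew_delta c t)) ->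
  forall x, P x.
Proof. by move=> P0 PD P1; apply: dsum_ind => // t c; exact: P1. Qed.

Definition skew_delta_mul (s t : G) (c d : C) : skewalg beta :=
  skew_delta (c * beta s d)%g (s * t)%g.

Definition skew_mul : skewalg beta -> skewalg beta -> skewalg beta :=
  dsum_mul skew_delta_mul.

Let linl s t d : linear (fun c => skew_delta_mul s t c d).
Proof.
by move=> a u v; rewrite /skew_delta_mul numul_linl; exact: dsum_single_linear.
Qed.

Let linr s t c : linear (skew_delta_mul s t c).
Proof.
move=> a u v; rewrite /skew_delta_mul alg_act_linear numul_linr.
exact: dsum_single_linear.
Qed.

Lemma skew_mul_delta c s d t :
  skew_mul (skew_delta c s) (skew_delta d t) =
  skew_delta (c * beta s d)%g (s * t)%g.
Proof. exact: dsum_mul_single. Qed.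

Fact skew_mulA : associative skew_mul.
Proof.
apply: dsum_mulA => // s t u c d e.
rewrite !dsum_mul_single // /skew_delta_mul alg_actM alg_act_comp.
by rewrite !mulgA.
Qed.

HB.instance Definition _ := isSemigroup.Build (skewalg beta) skew_mulA.

Lemma skew_mulE x y : (x * y)%g = skew_mul x y. Proof. by []. Qed.

HB.instance Definition _ := Semigroup_isNUAlgebra.Build k (skewalg beta)
  (dsum_mulDl linl) (dsum_mulDr linr) (dsum_mulZl linl) (dsum_mulZr linr).

Definition skew_grade (t : G) : set (skewalg beta) :=
  [set x | exists c, x = skew_delta c t].

Fact skew_grade0 t : skew_grade t 0.
Proof. by exists 0; rewrite /skew_delta dsum_single0. Qed.

Fact skew_gradeD t x y :
  skew_grade t x -> skew_grade t y -> skew_grade t (x + y).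
Proof.
by move=> [c ->] [d ->]; exists (c + d); rewrite /skew_delta dsum_singleD.
Qed.

Fact skew_gradeZ t a x : skew_grade t x -> skew_grade t (a *: x).
Proof. by move=> [c ->]; exists (a *: c); rewrite /skew_delta dsum_singleZ. Qed.

Fact skew_gradeM s t x y :
  skew_grade s x -> skew_grade t y -> skew_grade (s * t)%g (x * y)%g.
Proof.
move=> [c ->] [d ->]; exists (c * beta s d)%g.
by rewrite skew_mulE skew_mul_delta.
Qed.

Fact skew_grade_decomp x :
  exists! f : {fsfun G -> skewalg beta with 0},
    (forall t, skew_grade t (f t)) /\ x = \sum_(t <- finsupp f) f t.
Proof.
move: x; apply: direct_sum_decomp.
- exact: skew_gradeD.
- exact: skew_gradeZ.
- elim/skew_ind => [|x y|c t].
  + by apply: decomposable0 => ?; exact: skew_grade0.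
  + by apply: decomposableD => ? ? ?; exact: skew_gradeD.
  + apply: (@decomposable_gr _ _ _ _ skew_grade0 t).
    by exists c.
move=> f fg f0; apply/fsfunP => t; rewrite dsum0; apply/fsfunP => s.
have [c ftE] := fg t; rewrite ftE dsum_singleE dsum0; case: eqP => // _.
have /(congr1 (fun x : dsum G C => x t)) := f0.
rewrite /dsum_total /dsum_lift dsum_sum dsum0.
have -> : \sum_(i <- finsupp f) f i t = f t t.
  case: (finsuppP f t) => [tf|tf].
    rewrite dsum0 big_seq big1 // => i fi; have [d ->] := fg i.
    by rewrite dsum_singleE; case: eqP => // ti; rewrite ti fi in tf.
  rewrite (bigD1_seq t) ?fset_uniq //= big1 ?addr0 // => i it.
  by have [d ->] := fg i; rewrite dsum_singleE eq_sym (negbTE it).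
by rewrite ftE dsum_singleE eqxx.
Qed.

HB.instance Definition _ := NUAlgebra_isGraded.Build k G (skewalg beta)
  skew_grade0 skew_gradeD skew_gradeZ skew_grade_decomp skew_gradeM.

End Skew.

(* The action beta^B of [G] on [smash B], given by
   b e_{r,s} |-> b e_{tr,ts}. *)
Section SmashAction.
Context (k : comPzRingType) (G : groupType) (B : gradedAlgType k G).

Definition fmat_shift (t : G) : fmat G B -> fmat G B :=
  dsum_lift (fun p b => unit_mx b (t * p.1)%g (t * p.2)%g).

Let lin_shift t (p : G * G) :
  linear (fun b : B => unit_mx b (t * p.1)%g (t * p.2)%g).
Proof. exact: dsum_single_linear. Qed.

Lemma fmat_shift_linear t : linear (fmat_shift t).
Proof. exact: dsum_lift_linear. Qed.

HB.instance Definition _ t :=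
  GRing.isLinear.Build k (fmat G B) (fmat G B) _ (fmat_shift t)
    (fmat_shift_linear t).

Lemma fmat_shift_unit t b r s :
  fmat_shift t (unit_mx b r s) = unit_mx b (t * r)%g (t * s)%g.
Proof. exact: dsum_lift_single. Qed.

Lemma fmat_shiftE t M r s :
  fmat_shift t M (r, s) = M (t^-1 * r, t^-1 * s)%g.
Proof.
elim/fmat_ind: M => [|M N IHM IHN|b p q].
- by rewrite linear0 !dsum0.
- by rewrite linearD !dsumD IHM IHN.
rewrite fmat_shift_unit !unit_mxE !xpair_eqE.
have e x y : (x == t * y)%g = (t^-1 * x == y)%g.
  by apply/eqP/eqP => [->|<-]; rewrite ?mulKg ?mulVKg.
by rewrite !e.
Qed.

Lemma fmat_shiftM t M N :
  fmat_shift t (M * N)%g = (fmat_shift t M * fmat_shift t N)%g.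
Proof.
elim/fmat_ind: M => [|M M' IHM IHM'|b p q].
- by rewrite linear0 !numul0l linear0.
- by rewrite linearD !numulDl linearD /= IHM IHM'.
elim/fmat_ind: N => [|N N' IHN IHN'|b' p' q'].
- by rewrite linear0 !numul0r linear0.
- by rewrite linearD !numulDr linearD /= IHN IHN'.
rewrite !fmat_shift_unit !fmat_mulE.
rewrite !fmat_mul_unit (inj_eq (mulgI t)).
by case: eqP; rewrite ?linear0 ?fmat_shift_unit.
Qed.

Fact fmat_shift_smash t (x : smash B) :
  fmat_shift t (smash_val x) \in @smash_pred k G B.
Proof.
apply/smash_predP => r s; rewrite fmat_shiftE.
have := smash_valP x (t^-1 * r)%g (t^-1 * s)%g.
by rewrite invgM -mulgA mulKg.
Qed.

Definition smash_shift t (x : smash B) : smash B :=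
  Smash (fmat_shift_smash t x).

Fact smash_shift_linear t : linear (smash_shift t).
Proof. by move=> a x y; apply: val_inj; rewrite /= linearP. Qed.

Fact smash_shiftM t (x y : smash B) :
  smash_shift t (x * y)%g = (smash_shift t x * smash_shift t y)%g.
Proof. by apply: val_inj; exact: fmat_shiftM. Qed.

Fact smash_shift1 (x : smash B) : smash_shift 1%g x = x.
Proof.
by apply/val_inj/fsfunP => -[r s]; rewrite /= fmat_shiftE invg1 !mul1g.
Qed.

Fact smash_shift_comp s t (x : smash B) :
  smash_shift (s * t)%g x = smash_shift s (smash_shift t x).
Proof.
by apply/val_inj/fsfunP => -[r r']; rewrite /= !fmat_shiftE invgM -!mulgA.
Qed.

Definition smash_action : algAction G (smash B) :=
  AlgAction smash_shift_linear smash_shiftM smash_shift1 smash_shift_comp.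

End SmashAction.

Arguments smash_action {k G} B.

(* Componentwise application of a linear map. *)
Section DSumMap.
Context (k : comPzRingType) (K : choiceType) (V W : lmodType k).
Variable f : {linear V -> W}.

Definition dsum_map (x : dsum K V) : dsum K W :=
  [fsfun i in finsupp x => f (x i)].

Lemma dsum_mapE x i : dsum_map x i = f (x i).
Proof. by rewrite fsfunE; case: finsuppP => //; rewrite linear0. Qed.

Lemma dsum_map_linear : linear dsum_map.
Proof.
move=> a x y; apply/fsfunP => i.
by rewrite dsumD dsumZ !dsum_mapE dsumD dsumZ linearP.
Qed.

HB.instance Definition _ :=
  GRing.isLinear.Build k (dsum K V) (dsum K W) _ dsum_map dsum_map_linear.

Lemma dsum_map_single i v : dsum_map (dsum_single i v) = dsum_single i (f v).
Proof.
apply/fsfunP => j; rewrite dsum_mapE !dsum_singleE.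
by case: eqP; rewrite ?linear0.
Qed.

End DSumMap.

Section InducedHom.
Context (k : comPzRingType) (G : groupType) (A B : gradedAlgType k G).
Variable phi : graded_hom A B.

Definition fmat_map : fmat G A -> fmat G B := dsum_map phi.

HB.instance Definition _ :=
  GRing.isLinear.Build k (fmat G A) (fmat G B) _ fmat_map
    (dsum_map_linear phi).

Lemma fmat_mapE M p : fmat_map M p = phi (M p).
Proof. exact: dsum_mapE. Qed.

Lemma fmat_map_unit a r s : fmat_map (unit_mx a r s) = unit_mx (phi a) r s.
Proof. exact: dsum_map_single. Qed.

Fact fmat_mapM M N : fmat_map (M * N)%g = (fmat_map M * fmat_map N)%g.
Proof.
elim/fmat_ind: M => [|M M' IHM IHM'|b p q].
- by rewrite linear0 !numul0l linear0.
- by rewrite linearD !numulDl linearD /= IHM IHM'.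
elim/fmat_ind: N => [|N N' IHN IHN'|b' p' q'].
- by rewrite linear0 !numul0r linear0.
- by rewrite linearD !numulDr linearD /= IHN IHN'.
rewrite !fmat_map_unit !fmat_mulE.
rewrite !fmat_mul_unit.
by case: eqP; rewrite ?linear0 // fmat_map_unit graded_homM.
Qed.

Fact fmat_map_grade (t : G) (M : fmat G A) :
  grade t M -> grade t (fmat_map M).
Proof.
move: M; apply: span_ind => [|M N|a M|].
- by rewrite linear0; exact: grade0.
- by rewrite linearD; exact: gradeD.
- by rewrite linearZ; exact: gradeZ.
move=> _ [r [s [s' [a [ar <- ->]]]]]; rewrite fmat_map_unit.
apply: sub_span; exists r, s, s', (phi a).
by split=> //; exact: graded_hom_grade.
Qed.

(* The homomorphism FMat_G(A) -> FMat_G(B) induced by [phi]. *)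
Definition fmat_hom : graded_hom (fmat G A) (fmat G B) :=
  GradedHom fmat_mapM fmat_map_grade.

Fact smash_map_subproof (x : smash A) :
  fmat_map (smash_val x) \in @smash_pred k G B.
Proof.
apply/smash_predP => r s; rewrite fmat_mapE.
exact/graded_hom_grade/smash_valP.
Qed.

Definition smash_map (x : smash A) : smash B := Smash (smash_map_subproof x).

Fact smash_map_linear : linear smash_map.
Proof. by move=> a x y; apply: val_inj; rewrite /= linearP. Qed.

HB.instance Definition _ :=
  GRing.isLinear.Build k (smash A) (smash B) _ smash_map smash_map_linear.

Fact smash_mapM x y : smash_map (x * y)%g = (smash_map x * smash_map y)%g.
Proof. by apply: val_inj; exact: fmat_mapM. Qed.

Fact smash_map_action t x :
  smash_map (smash_action A t x) = smash_action B t (smash_map x).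
Proof.
apply/val_inj/fsfunP => -[r s].
by rewrite /= fmat_mapE !fmat_shiftE fmat_mapE.
Qed.

Definition smash_skew_map :
  skewalg (smash_action A) -> skewalg (smash_action B) := dsum_map smash_map.

HB.instance Definition _ :=
  GRing.isLinear.Build k (skewalg (smash_action A)) (skewalg (smash_action B)) _
    smash_skew_map (dsum_map_linear smash_map).

Lemma smash_skew_map_delta c t :
  smash_skew_map (skew_delta _ c t) = skew_delta _ (smash_map c) t.
Proof. exact: dsum_map_single. Qed.

Fact smash_skew_mapM x y :
  smash_skew_map (x * y)%g = (smash_skew_map x * smash_skew_map y)%g.
Proof.
elim/skew_ind: x => [|x x' IHx IHx'|c s].
- by rewrite linear0 !numul0l linear0.
- by rewrite linearD !numulDl linearD /= IHx IHx'.
elim/skew_ind: y => [|y y' IHy IHy'|d t].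
- by rewrite linear0 !numul0r linear0.
- by rewrite linearD !numulDr linearD /= IHy IHy'.
rewrite !smash_skew_map_delta !skew_mulE !skew_mul_delta.
by rewrite smash_skew_map_delta smash_mapM smash_map_action.
Qed.

Fact smash_skew_map_grade (t : G) (x : skewalg (smash_action A)) :
  grade t x -> grade t (smash_skew_map x).
Proof. by move=> [c ->]; exists (smash_map c); exact: smash_skew_map_delta. Qed.

(* The homomorphism (A # G) x| G -> (B # G) x| G induced by [phi]. *)
Definition smash_skew_hom :
    graded_hom (skewalg (smash_action A)) (skewalg (smash_action B)) :=
  GradedHom smash_skew_mapM smash_skew_map_grade.

End InducedHom.

(* Main.v *)
Require Import Defs.
From mathcomp Require Import all_boot all_order all_algebra finmap.
From mathcomp Require Import boolp classical_sets.
From HB Require Import structures.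

(** The isomorphism sends [c delta_t] to [c P_t], where [c] is read as a matrix
    and [P_t] is the permutation matrix whose entry [(r, s)] is [1] exactly
    when [r = ts].  Conjugation by [P_t] is the action [beta_t], so
    [c P_t d P_u = c beta_t(d) P_{tu}], which is the multiplication rule of the
    skew group algebra.  As [B] need not have a unit and [G] may be infinite,
    [P_t] is not a matrix in [fmat G B]; only right multiplication by it,
    [b e_{r,s} |-> b e_{r,t^-1 s}], makes sense there.  It is the map
    [col_shift t], and the rule above is [col_shiftM].

    The map is bijective because it is so in every degree.  A matrix has
    degree [t] exactly when its entry at [(r, s)] lies in [B_{r^-1 t s}] for
    all [r], [s] ([fmat_gradeP]), whereas [B # G] consists of the matrices with
    entry in [B_{r^-1 s}] at [(r, s)].  So [col_shift t], which moves the
    entry at [(r, ts)] to [(r, s)], maps [B # G] onto the component of degree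
    [t], with inverse [col_shift t^-1].  A homomorphism of graded algebras that
    is bijective in every degree is an isomorphism of graded algebras
    ([graded_iso_homogeneous]).  Naturality holds because moving entries
    commutes with applying a map to each entry. *)

Set Implicit Arguments.
Unset Strict Implicit.
Unset Printing Implicit Defensive.

Import GRing.Theory.

Section GradedIso.
Context (k : comPzRingType) (G : groupType) (A B : gradedAlgType k G).
Variable f : graded_hom A B.

Local Open Scope ring_scope.

(** Homogeneous components of different degrees are independent, so an element
    of the kernel has all its components in the kernel; and the homogeneous
    elements span [B], so [f] is onto.  The inverse respects degrees because a
    homogeneous [y] has a preimage of its own degree, which is its only one. *)
Lemma graded_iso_homogeneous :
    (forall t x, grade t x -> f x = 0 -> x = 0) ->
    (forall t y, grade t y -> exists2 x, grade t x & f x = y) ->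
  graded_iso f.
Proof.
move=> inj_gr surj_gr.
have ker0 x : f x = 0 -> x = 0.
  have [h [[gh xE] _]] := grade_decomp x.
  move=> fx0; have fh0 : dsum_map f h = 0.
    apply: grade_inj0 => [t|].
      by rewrite dsum_mapE; exact: graded_hom_grade.
    rewrite /dsum_total (@dsum_lift_widen _ _ _ _ _ _ (finsupp h)) //.
      under eq_bigr do rewrite dsum_mapE.
      by rewrite -linear_sum -xE.
    apply/fsubsetP => t; rewrite !mem_finsupp dsum_mapE.
    by apply: contra_neq => ->; rewrite linear0.
  rewrite xE big1 // => t _; apply: inj_gr (gh t) _.
  by rewrite -dsum_mapE fh0 dsum0.
have inj : injective f.
  by move=> x y fxy; apply/eqP; rewrite -subr_eq0; apply/eqP/ker0;
    rewrite linearB /= fxy subrr.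
have surj y : exists x, f x = y.
  have [h [[gh ->] _]] := grade_decomp y.
  elim/big_ind: _ => [|_ _ [x <-] [x' <-]|t _].
  - by exists 0; rewrite linear0.
  - by exists (x + x'); rewrite linearD.
  - by have [x _ <-] := surj_gr t _ (gh t); exists x.
have [g fgK] := choice surj.
have gfK : cancel f g by move=> x; apply: inj; rewrite fgK.
have g_lin : linear g by move=> a x y; apply: inj; rewrite linearP !fgK.
pose gL : {linear B -> A} := HB.pack g (GRing.isLinear.Build k B A _ g g_lin).
have gM x y : gL (x * y)%g = (gL x * gL y)%g.
  by apply: inj; rewrite graded_homM /= !fgK.
have g_grade (t : G) x : grade t x -> grade t (gL x).
  by move=> /surj_gr [z zt <-]; rewrite /= gfK.
by exists (GradedHom gM g_grade).
Qed.

End GradedIso.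

Section ColumnShift.
Context (k : comPzRingType) (G : groupType) (B : gradedAlgType k G).

Local Open Scope ring_scope.

(** If [M(s,t)] has degree [s^-1 u t], then [M(s,t) e_{s,t}] is one of the
    elements spanning the component of degree [u]; [M] is the sum of these. *)
Lemma fmat_gradeP u (M : fmat G B) :
  grade u M <-> forall s t, grade (s^-1 * u * t)%g (M (s, t)).
Proof.
split=> [|Mu]; first exact: fmat_grade_entry.
rewrite [M]dsum_expand; elim/big_ind: _ => [|x y|[s t] _].
- exact: grade0.
- exact: gradeD.
apply: Defs.sub_span; exists (s^-1 * u * t)%g, s, t, (M (s, t)).
by split=> //; rewrite -!mulgA mulgV mulg1 mulVKg.
Qed.

Definition col_shift (t : G) : fmat G B -> fmat G B :=
  dsum_lift (fun p b => unit_mx b p.1 (t^-1 * p.2)%g).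

Let lin_shift t (p : G * G) :
  linear (fun b : B => unit_mx b p.1 (t^-1 * p.2)%g).
Proof. exact: dsum_single_linear. Qed.

Lemma col_shift_linear t : linear (col_shift t).
Proof. exact: dsum_lift_linear. Qed.

HB.instance Definition _ t :=
  GRing.isLinear.Build k (fmat G B) (fmat G B) _ (col_shift t)
    (col_shift_linear t).

Lemma col_shift_unit t b r s :
  col_shift t (unit_mx b r s) = unit_mx b r (t^-1 * s)%g.
Proof. exact: dsum_lift_single. Qed.

Lemma col_shiftE t M r s : col_shift t M (r, s) = M (r, t * s)%g.
Proof.
elim/fmat_ind: M => [|M N IHM IHN|b p q].
- by rewrite linear0 !dsum0.
- by rewrite linearD !dsumD IHM IHN.
rewrite col_shift_unit !unit_mxE !xpair_eqE.
suff -> : (s == t^-1 * q)%g = (t * s == q)%g by [].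
by apply/eqP/eqP => [->|<-]; rewrite ?mulKg ?mulVKg.
Qed.

Lemma col_shift_inj t : injective (col_shift t).
Proof.
move=> M N MN; apply/fsfunP => -[r s].
by rewrite -[s](mulVKg t) -!col_shiftE MN.
Qed.

(** The rule [c P_t d P_u = c beta_t(d) P_{tu}]. *)
Lemma col_shiftM t u M N :
  (col_shift t M * col_shift u N)%g =
  col_shift (t * u)%g (M * fmat_shift t N)%g.
Proof.
elim/fmat_ind: M => [|M M' IHM IHM'|b p q].
- by rewrite linear0 !numul0l linear0.
- by rewrite linearD !numulDl linearD /= IHM IHM'.
elim/fmat_ind: N => [|N N' IHN IHN'|b' p' q'].
- by rewrite !linear0 !numul0r linear0.
- by rewrite !linearD !numulDr linearD /= IHN IHN'.
rewrite fmat_shift_unit !col_shift_unit !fmat_mulE !fmat_mul_unit.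
have -> : (t^-1 * q == p')%g = (q == t * p')%g.
  by apply/eqP/eqP => [<-|->]; rewrite ?mulKg ?mulVKg.
case: eqP => _; last by rewrite linear0.
by rewrite col_shift_unit invgM -mulgA mulKg.
Qed.

Lemma col_shift_grade t (c : smash B) : grade t (col_shift t (smash_val c)).
Proof.
by apply/fmat_gradeP => r s; rewrite col_shiftE -mulgA; exact: smash_valP.
Qed.

Lemma col_shift_smash t (M : fmat G B) : grade t M ->
  exists c : smash B, col_shift t (smash_val c) = M.
Proof.
move=> /fmat_gradeP Mt.
have c_in : col_shift t^-1 M \in @smash_pred k G B.
  apply/smash_predP => r s; rewrite col_shiftE.
  by have := Mt r (t^-1 * s)%g; rewrite -mulgA mulVKg.
exists (Smash c_in); apply/fsfunP => -[r s] /=.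
by rewrite !col_shiftE mulKg.
Qed.

End ColumnShift.

Section SkewToMatrix.
Context (k : comPzRingType) (G : groupType) (B : gradedAlgType k G).

Local Open Scope ring_scope.

Definition skew_fmat : skewalg (smash_action B) -> fmat G B :=
  dsum_lift (fun t c => col_shift t (smash_val c)).

Let lin_component (t : G) :
  linear (fun c : smash B => col_shift t (smash_val c)).
Proof. by move=> a c d; rewrite -linearP. Qed.

Lemma skew_fmat_linear : linear skew_fmat.
Proof. exact: dsum_lift_linear. Qed.

HB.instance Definition _ :=
  GRing.isLinear.Build k (skewalg (smash_action B)) (fmat G B) _ skew_fmat
    skew_fmat_linear.

Lemma skew_fmat_delta c t :
  skew_fmat (skew_delta _ c t) = col_shift t (smash_val c).
Proof. exact: dsum_lift_single. Qed.

Lemma skew_fmatM x y : skew_fmat (x * y)%g = (skew_fmat x * skew_fmat y)%g.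
Proof.
elim/skew_ind: x => [|x x' IHx IHx'|c s].
- by rewrite linear0 !numul0l linear0.
- by rewrite linearD !numulDl linearD /= IHx IHx'.
elim/skew_ind: y => [|y y' IHy IHy'|d t].
- by rewrite linear0 !numul0r linear0.
- by rewrite linearD !numulDr linearD /= IHy IHy'.
by rewrite skew_mulE skew_mul_delta !skew_fmat_delta col_shiftM.
Qed.

Lemma skew_fmat_grade (t : G) (x : skewalg (smash_action B)) :
  grade t x -> grade t (skew_fmat x).
Proof. by move=> [c ->]; rewrite skew_fmat_delta; exact: col_shift_grade. Qed.

Definition skew_fmat_hom : graded_hom (skewalg (smash_action B)) (fmat G B) :=
  GradedHom skew_fmatM skew_fmat_grade.

Lemma skew_fmat_iso : graded_iso skew_fmat_hom.
Proof.
apply: graded_iso_homogeneous => [t _ [c ->]|t M /col_shift_smash [c <-]].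
  rewrite /= skew_fmat_delta -(linear0 (col_shift t)) => /col_shift_inj c0.
  by rewrite (_ : c = 0) ?/skew_delta ?dsum_single0 //; exact: val_inj.
by exists (skew_delta _ c t); [exists c | exact: skew_fmat_delta].
Qed.

End SkewToMatrix.

Lemma skew_fmat_natural (k : comPzRingType) (G : groupType)
    (A B : gradedAlgType k G) (phi : graded_hom A B)
    (x : skewalg (smash_action A)) :
  skew_fmat (smash_skew_map phi x) = fmat_map phi (skew_fmat x).
Proof.
elim/skew_ind: x => [|x y IHx IHy|c t].
- by rewrite !linear0.
- by rewrite !linearD /= IHx IHy.
rewrite smash_skew_map_delta !skew_fmat_delta; apply/fsfunP => -[r s].
by rewrite fmat_mapE !col_shiftE /= fmat_mapE.
Qed.

Theorem theorem2p1 (k : comPzRingType) (G : groupType) :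
  exists Phi : forall B : gradedAlgType k G,
      graded_hom (skewalg (smash_action B)) (fmat G B),
    (forall B : gradedAlgType k G, graded_iso (Phi B)) /\
    (forall (A B : gradedAlgType k G) (phi : graded_hom A B)
        (x : skewalg (smash_action A)),
      Phi B (smash_skew_hom phi x) = fmat_hom phi (Phi A x)).
Proof.
exists (@skew_fmat_hom k G); split=> [B|A B phi x].
  exact: skew_fmat_iso.
exact: skew_fmat_natural.
Qed.
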